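(* Fix $0<\delta<1$. If $\mathcal{A}$ is a nearly isometric random variable taking values in linear maps from $\mathbb{R}^{m\times n}$ to $\mathbb{R}^p$, then for every $1\le r\le m$ there exist constants $c_0,c_1>0$ depending only on $\delta$ such that, with probability at least $1-\exp(-c_1p)$, one has $\delta_r(\mathcal{A})\le\delta$ whenever $p\ge c_0\,r(m+n)\log(mn)$.
   Context: Norms: $\|X\|_F$ is the Frobenius norm of a matrix, $\|\mathcal{A}(X)\|$ is the Euclidean norm in $\mathbb{R}^p$, and $\|\mathcal{A}\|$ is the operator norm of $\mathcal{A}$ as a linear map from $(\mathbb{R}^{m\times n},\|\cdot\|_F)$ to $(\mathbb{R}^p,\|\cdot\|)$. Nearly isometric: a random variable $\mathcal{A}$ taking values in linear maps $\mathbb{R}^{m\times n}\to\mathbb{R}^p$ is called nearly isometric (nearly isometrically distributed) if (1) for all $X\in\mathbb{R}^{m\times n}$, $\mathbf{E}[\|\mathcal{A}(X)\|^2]=\|X\|_F^2$; (2) for all $X\in\mathbb{R}^{m\times n}$ and all $0<\epsilon<1$, $$\mathbf{P}\big(\,|\|\mathcal{A}(X)\|^2-\|X\|_F^2|\ge\epsilon\|X\|_F^2\,\big)\le 2\exp\!\left(-\tfrac p2\big(\epsilon^2/2-\epsilon^3/3\big)\right);$$ and (3) for all $t>0$, $$\mathbf{P}\left(\|\mathcal{A}\|\ge 1+\sqrt{\tfrac{mn}{p}}+t\right)\le\exp(-\gamma p t^2)$$ for some constant $\gamma>0$. Here $\gamma$ is a fixed absolute constant, not depending on $m,n,p,r$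 and fixed before $c_0,c_1$ are chosen. Restricted isometry constant: for a linear map $\mathcal{A}:\mathbb{R}^{m\times n}\to\mathbb{R}^p$, where without loss of generality $m\le n$, and for every integer $r$ with $1\le r\le m$, $\delta_r(\mathcal{A})$ is the smallest number such that $$(1-\delta_r(\mathcal{A}))\|X\|_F\le\|\mathcal{A}(X)\|\le(1+\delta_r(\mathcal{A}))\|X\|_F$$ for all $X\in\mathbb{R}^{m\times n}$ of rank at most $r$.
   Formalization: The case m = n = 1 is excluded, since there log(mn) = 0 makes the bound on p empty and the claim fails; and condition (2) of nearly isometric is required only for X ≠ 0, since at X = 0 it cannot hold for large p. *)

(* Defs.v *)
From HB Require Import structures.
From mathcomp Require Import all_boot all_order all_algebra.
From mathcomp Require Import all_classical all_reals all_analysis.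

Set Implicit Arguments.
Unset Strict Implicit.
Unset Printing Implicit Defensive.

Import Order.TTheory GRing.Theory Num.Theory.
Import numFieldNormedType.Exports.

Local Open Scope classical_set_scope.
Local Open Scope ring_scope.

(* The library's own norm `|X| on matrices is the max norm. *)
Definition frobenius (R : realType) (m n : nat) (X : 'M[R]_(m, n)) : R :=
  Num.sqrt (\sum_(i < m) \sum_(j < n) X i j ^+ 2).

Definition euclidean (R : realType) (p : nat) (v : 'cV[R]_p) : R :=
  Num.sqrt (\sum_(i < p) v i 0 ^+ 2).

(* The supremum is that of a nonempty bounded set, the domain being
   finite-dimensional. *)
Definition opnorm (R : realType) (m n p : nat)
    (A : {linear 'M[R]_(m, n) -> 'cV[R]_p}) : R :=
  sup [set euclidean (A X) | X in [set X : 'M[R]_(m, n) | frobenius X <= 1]].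

(* Measurability for the Borel sigma-algebra of the finite-dimensional space of
   linear maps, which is generated by the coordinates of the evaluations. *)
Definition measurable_linear_map (R : realType) (d : measure_display)
    (T : measurableType d) (m n p : nat)
    (A : T -> {linear 'M[R]_(m, n) -> 'cV[R]_p}) : Prop :=
  forall (X : 'M[R]_(m, n)) (i : 'I_p),
    measurable_fun [set: T] (fun w => A w X i 0).

(* The concentration bound is required of nonzero matrices only: at X = 0 the
   event is the whole space while the bound is below 1 for p >= 9 and eps close
   to 1, so including X = 0 would make the definition unsatisfiable. *)
Definition nearly_isometric (R : realType) (gamma : R) (d : measure_display)
    (T : measurableType d) (P : probability T R) (m n p : nat)
    (A : T -> {linear 'M[R]_(m, n) -> 'cV[R]_p}) : Prop :=
  [/\ measurable_linear_map A,
      forall X : 'M[R]_(m, n),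
        ('E_P[fun w => (euclidean (A w X) ^+ 2)%R] = (frobenius X ^+ 2)%:E)%E,
      forall (X : 'M[R]_(m, n)) (eps : R), X != 0 -> 0 < eps -> eps < 1 ->
        (P [set w | (eps * frobenius X ^+ 2 <=
                     `|euclidean (A w X) ^+ 2 - frobenius X ^+ 2|)%R] <=
         (2 * expR (- (p%:R / 2 * (eps ^+ 2 / 2 - eps ^+ 3 / 3))))%:E)%E
    & forall t : R, 0 < t ->
        (P [set w | (1 + Num.sqrt ((m * n)%:R / p%:R) + t <= opnorm (A w))%R] <=
         (expR (- (gamma * p%:R * t ^+ 2)))%:E)%E].

Definition rip_bounds (R : realType) (m n p : nat)
    (A : {linear 'M[R]_(m, n) -> 'cV[R]_p}) (r : nat) : set R :=
  [set delta | forall X : 'M[R]_(m, n), (\rank X <= r)%N ->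
     (1 - delta) * frobenius X <= euclidean (A X) <=
     (1 + delta) * frobenius X].

(* For 1 <= r <= m <= n the set is nonempty, closed and bounded below, so the
   infimum is its least element. *)
Definition restricted_isometry_constant (R : realType) (m n p : nat)
    (A : {linear 'M[R]_(m, n) -> 'cV[R]_p}) (r : nat) : R :=
  inf (rip_bounds A r).

(* Main.v *)
Require Import Defs.
From HB Require Import structures.
From mathcomp Require Import all_boot all_order all_algebra.
From mathcomp Require Import all_classical all_reals all_analysis.
From mathcomp Require Import measurable_realfun.
From mathcomp Require Import ring lra.

Set Implicit Arguments.
Unset Strict Implicit.
Unset Printing Implicit Defensive.

Import Order.TTheory GRing.Theory Num.Theory.
Import numFieldNormedType.Exports.

Local Open Scope classical_set_scope.
Local Open Scope ring_scope.

(** The matrices of rank at most r and Frobenius norm 1 are approximated by a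
    finite net that does not depend on the random map, concentration is applied
    at each net point, and a union bound is taken.

    Such a matrix factors as U V with r columns in U, r rows in V and all entries
    in [-1, 1] ([bounded_factorization]).  Rounding these entries to multiples of
    1/K gives a net of at most (2K + 1)^(r(m + n)) products, within 2mnr/K of
    every such matrix in the l1 norm of the entries ([net_point_approx]).  The factor log(mn) in the lower
    bound on p pays for the crude choice K = Q (mn)^2, where Q depends on delta
    only: the logarithm of the size of the net is of order
    r(m + n)(1 + log(mn)).  Each point violates the bounds 1 - delta/2 and
    1 + delta/2 with probability at most 2 exp(-kappa p), so for such p all of
    them satisfy these bounds with probability at least 1 - exp(-kappa p / 2)
    ([net_bounds_probability], [net_union_bound]).

    Passing from the net to all matrices is deterministic ([net_bounds_rip]).
    The elementary matrices are net points, so their images have norm at most 2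
    on the good event; hence the image of any E has norm at most twice the sum
    of the absolute values of its entries, and for a rounding error this sum is
    at most 2/Q.  Thus the concentration inequality on the net controls the
    operator norm as well, with a loss polynomial in mn which the fineness of
    the grid absorbs.

    The event in the conclusion has to be measurable for monotonicity of the
    probability to apply to it.  This too comes from the nets: the
    restricted isometry constant is at most delta exactly when the bounds hold
    at every point of every net ([rip_bounds_netP]), which is a countable
    intersection. *)

(** * Cauchy-Schwarz and the triangle inequality *)

(** Lagrange's identity: twice the defect is the sum of the squares
    (f i * g j - f j * g i) ^+ 2. *)
Lemma sum_cauchy_schwarz (R : realDomainType) (I : finType) (f g : I -> R) :
  (\sum_i f i * g i) ^+ 2 <= (\sum_i f i ^+ 2) * (\sum_i g i ^+ 2).
Proof.
have E : 0 <= \sum_i \sum_j (f i * g j - f j * g i) ^+ 2.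
  by apply: sumr_ge0 => i _; apply: sumr_ge0 => j _; exact: sqr_ge0.
have H : \sum_i \sum_j (f i * g j - f j * g i) ^+ 2 =
    ((\sum_i f i ^+ 2) * (\sum_i g i ^+ 2) - (\sum_i f i * g i) ^+ 2) *+ 2.
  pose a i j := f i ^+ 2 * g j ^+ 2.
  pose b i j := (f i * g i) * (f j * g j).
  transitivity (\sum_i \sum_j (a i j + a j i - b i j *+ 2)).
    by apply: eq_bigr => i _; apply: eq_bigr => j _; rewrite /a /b; ring.
  have Ha : (\sum_i f i ^+ 2) * (\sum_i g i ^+ 2) = \sum_i \sum_j a i j.
    by rewrite mulr_suml; apply: eq_bigr => i _; rewrite mulr_sumr.
  have Hb : (\sum_i f i * g i) ^+ 2 = \sum_i \sum_j b i j.
    by rewrite expr2 mulr_suml; apply: eq_bigr => i _; rewrite mulr_sumr.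
  rewrite Ha Hb mulrnBl [in RHS]mulr2n [X in _ = _ + X - _]exchange_big /=.
  rewrite -big_split -sumrMnl -sumrB; apply: eq_bigr => i _.
  by rewrite -big_split -sumrMnl -sumrB.
by rewrite H pmulrn_lge0 // subr_ge0 in E.
Qed.

Lemma sqrt_sum_sqrD (R : rcfType) (I : finType) (f g : I -> R) :
  Num.sqrt (\sum_i (f i + g i) ^+ 2) <=
  Num.sqrt (\sum_i f i ^+ 2) + Num.sqrt (\sum_i g i ^+ 2).
Proof.
have sum0 (h : I -> R) : 0 <= \sum_i h i ^+ 2.
  by apply: sumr_ge0 => i _; exact: sqr_ge0.
have := sum_cauchy_schwarz f g; set F := \sum_i f i ^+ 2; set G := \sum_i g i ^+ 2.
have F0 : 0 <= F := sum0 f; have G0 : 0 <= G := sum0 g.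
set c := \sum_i _ => cFG.
have cs : c <= Num.sqrt F * Num.sqrt G.
  by rewrite -sqrtrM // (le_trans (ler_norm c)) // -sqrtr_sqr ler_wsqrtr.
rewrite -[leRHS]ger0_norm ?addr_ge0 ?sqrtr_ge0 // -sqrtr_sqr ler_wsqrtr //.
rewrite sqrrD !sqr_sqrtr //.
have -> : \sum_i (f i + g i) ^+ 2 = F + c *+ 2 + G.
  by rewrite -sumrMnl -!big_split; apply: eq_bigr => i _ /=; rewrite sqrrD.
by rewrite lerD2r lerD2l lerMn2r.
Qed.

(** * Frobenius and Euclidean norms *)

Section Norms.
Variable R : realType.

Lemma frobenius_ge0 m n (X : 'M[R]_(m, n)) : 0 <= frobenius X.
Proof. exact: sqrtr_ge0. Qed.

Lemma euclidean_ge0 p (v : 'cV[R]_p) : 0 <= euclidean v.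
Proof. exact: sqrtr_ge0. Qed.

Lemma euclideanD p (u v : 'cV[R]_p) :
  euclidean (u + v) <= euclidean u + euclidean v.
Proof.
rewrite /euclidean; under eq_bigr do rewrite mxE.
exact: sqrt_sum_sqrD.
Qed.

Lemma euclideanZ p a (v : 'cV[R]_p) : euclidean (a *: v) = `|a| * euclidean v.
Proof.
rewrite /euclidean; under eq_bigr do rewrite mxE exprMn.
by rewrite -mulr_sumr sqrtrM ?sqr_ge0 // sqrtr_sqr.
Qed.

Lemma frobeniusD m n (X Y : 'M[R]_(m, n)) :
  frobenius (X + Y) <= frobenius X + frobenius Y.
Proof.
rewrite /frobenius !pair_bigA /=; under eq_bigr do rewrite mxE.
exact: (sqrt_sum_sqrD (fun ij => X ij.1 ij.2) (fun ij => Y ij.1 ij.2)).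
Qed.

Lemma frobeniusZ m n a (X : 'M[R]_(m, n)) :
  frobenius (a *: X) = `|a| * frobenius X.
Proof.
rewrite /frobenius !pair_bigA /=; under eq_bigr do rewrite mxE exprMn.
by rewrite -mulr_sumr sqrtrM ?sqr_ge0 // sqrtr_sqr.
Qed.

Lemma frobenius_delta m n (i : 'I_m) (j : 'I_n) :
  frobenius (delta_mx i j : 'M[R]_(m, n)) = 1.
Proof.
rewrite /frobenius (bigD1 i) //= (bigD1 j) //= !big1 ?addr0.
- by rewrite mxE !eqxx expr1n sqrtr1.
- by move=> k /negPf ki; rewrite big1 // => l _; rewrite mxE ki expr0n.
- by move=> l /negPf lj; rewrite mxE lj andbF expr0n.
Qed.

Lemma frobenius_eq0 m n (X : 'M[R]_(m, n)) : frobenius X = 0 -> X = 0.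
Proof.
move/eqP; rewrite sqrtr_eq0 => X0; apply/matrixP => i j; rewrite mxE.
have /eqP : \sum_i \sum_j X i j ^+ 2 = 0.
  apply/eqP; rewrite eq_le X0 sumr_ge0 // => k _.
  by apply: sumr_ge0 => l _; exact: sqr_ge0.
rewrite psumr_eq0 => [/allP /(_ i)|k _]; last first.
  by apply: sumr_ge0 => l _; exact: sqr_ge0.
rewrite mem_index_enum /= => /(_ isT); rewrite psumr_eq0 => [|l _]; last exact: sqr_ge0.
by move/allP => /(_ j); rewrite mem_index_enum sqrf_eq0 => /(_ isT) /eqP.
Qed.

Definition entry_sum m n (X : 'M[R]_(m, n)) : R := \sum_i \sum_j `|X i j|.

(** Expand X on the elementary matrices.  This serves both for the Frobenius norm
    and for the Euclidean norm of the image under a linear map. *)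
Lemma subadditive_le_entry_sum m n (N : 'M[R]_(m, n) -> R) B :
    (forall X Y, N (X + Y) <= N X + N Y) ->
    (forall a X, N (a *: X) = `|a| * N X) ->
    (forall i j, N (delta_mx i j) <= B) ->
  forall X, N X <= B * entry_sum X.
Proof.
move=> ND NZ Nd X; have N0 : N 0 = 0 by rewrite -(scale0r 0) NZ normr0 mul0r.
have Nsum k (F : 'I_k -> 'M[R]_(m, n)) : N (\sum_i F i) <= \sum_i N (F i).
  elim/big_rec2: _ => [|i y x _ xy]; first by rewrite N0.
  by rewrite (le_trans (ND _ _)) // lerD2l.
rewrite [X in N X]matrix_sum_delta mulr_sumr (le_trans (Nsum _ _)) //.
apply: ler_sum => i _; rewrite mulr_sumr (le_trans (Nsum _ _)) //.
by apply: ler_sum => j _; rewrite NZ mulrC ler_wpM2r.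
Qed.

Lemma frobenius_le_entry_sum m n (X : 'M[R]_(m, n)) : frobenius X <= entry_sum X.
Proof.
rewrite -[leRHS]mul1r; apply: subadditive_le_entry_sum => [? ?|? ?|i j].
- exact: frobeniusD.
- exact: frobeniusZ.
- by rewrite frobenius_delta.
Qed.

Lemma entry_sum_le m n (X : 'M[R]_(m, n)) c :
  (forall i j, `|X i j| <= c) -> entry_sum X <= c * (m * n)%:R.
Proof.
move=> Xc; have -> : c * (m * n)%:R = \sum_(i < m) \sum_(j < n) c.
  by rewrite !sumr_const !card_ord -mulrnA mulnC mulr_natr.
by apply: ler_sum => i _; apply: ler_sum.
Qed.

(** * Low-rank factorization with bounded factors *)

(** Gram-Schmidt deflation: if q is a normalized nonzero row of X, subtracting
    from every row its component along q lowers the rank, since q lies in the row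
    space of X and is orthogonal to the new rows.  The coefficients split off are
    inner products of rows with unit vectors, and the remaining rows do not get
    longer, so all entries stay bounded by 1 whatever the rank.  (Pivoting on an
    entry instead would let them double at each step.) *)
Lemma bounded_factorization m n r (X : 'M[R]_(m, n)) :
    (\rank X <= r)%N -> (forall i, \sum_j X i j ^+ 2 <= 1) ->
  exists U : 'M[R]_(m, r), exists V : 'M[R]_(r, n),
    [/\ X = U *m V, forall i k, `|U i k| <= 1 & forall k j, `|V k j| <= 1].
Proof.
elim: r X => [|r IH] X rX X1.
  exists 0, 0; split=> [|i k|k j]; try by rewrite mxE normr0.
  by rewrite mul0mx; apply/eqP; rewrite -mxrank_eq0 -leqn0.
have [->|X0] := eqVneq X 0.
  by exists 0, 0; split=> [|i k|k j]; rewrite ?mul0mx // mxE normr0.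
have /existsP[i0 xi0] : [exists i, row i X != 0].
  apply: contraNT X0; rewrite negb_exists => /forallP rows0.
  by apply/eqP/row_matrixP => i; move: (rows0 i); rewrite negbK linear0 => /eqP.
pose s := \sum_j X i0 j ^+ 2.
have s_ge0 : 0 <= s by apply: sumr_ge0 => j _; exact: sqr_ge0.
have s_gt0 : 0 < s.
  rewrite lt_def s_ge0 andbT; apply: contraNneq xi0 => s0.
  apply/eqP/rowP => j; rewrite !mxE; apply/eqP; rewrite -sqrf_eq0.
  have := s0; move/eqP; rewrite psumr_eq0 => [|k _]; last exact: sqr_ge0.
  by move/allP/(_ j); rewrite mem_index_enum => /(_ isT).
pose q : 'rV[R]_n := (Num.sqrt s)^-1 *: row i0 X.
have q1 : \sum_j q 0 j ^+ 2 = 1.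
  under eq_bigr do rewrite !mxE exprMn.
  by rewrite -mulr_sumr exprVn sqr_sqrtr // mulVf // gt_eqF.
pose u : 'cV[R]_m := X *m q^T.
pose Y := X - u *m q.
have Yq : Y *m q^T = 0.
  have qq : q *m q^T = 1%:M.
    apply/matrixP => i j; rewrite !ord1 !mxE -[RHS]q1.
    by apply: eq_bigr => k _; rewrite !mxE expr2.
  by rewrite mulmxBl -mulmxA qq mulmx1 subrr.
have uE i : u i 0 = \sum_j X i j * q 0 j.
  by rewrite mxE; apply: eq_bigr => j _; rewrite !mxE.
(* Pythagoras, row by row: u i 0 is the inner product of row i with q. *)
have rowY i : \sum_j Y i j ^+ 2 = \sum_j X i j ^+ 2 - u i 0 ^+ 2.
  transitivity (\sum_j (X i j ^+ 2 - (X i j * q 0 j) * (u i 0 *+ 2)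
                        + q 0 j ^+ 2 * u i 0 ^+ 2)).
    apply: eq_bigr => j _.
    have -> : Y i j = X i j - u i 0 * q 0 j.
      transitivity (X i j - (u *m q) i j); first by rewrite !mxE.
      by congr (_ - _); rewrite [LHS]mxE big_ord1.
    ring.
  by rewrite big_split sumrB /= -!mulr_suml -uE q1; ring.
have u1 i : `|u i 0| <= 1.
  rewrite -(@ler_pXn2r _ 2) ?nnegrE // expr1n real_normK ?num_real //.
  rewrite (le_trans _ (X1 i)) // -subr_ge0 -rowY.
  by apply: sumr_ge0 => j _; exact: sqr_ge0.
have qv1 j : `|q 0 j| <= 1.
  rewrite -(@ler_pXn2r _ 2) ?nnegrE // expr1n real_normK ?num_real //.
  by rewrite -q1 (bigD1 j) //= lerDl sumr_ge0 // => k _; exact: sqr_ge0.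
have sYX : (Y <= X)%MS.
  rewrite addmx_sub ?submx_refl // -scaleN1r scalemx_sub //.
  by rewrite /q -scalemxAr scalemx_sub // (submx_trans (submxMl _ _)) // row_sub.
have rY : (\rank Y <= r)%N.
  rewrite -ltnS (leq_trans _ rX) // (ltn_leqif (mxrank_leqif_sup sYX)).
  (* Otherwise row i0 would be orthogonal to its own normalization. *)
  apply/negP => sXY; have /submxP[c cE] : (row i0 X <= Y)%MS.
    exact: submx_trans (row_sub _ _) sXY.
  suff : s = 0 by move/eqP; rewrite gt_eqF.
  have : row i0 X *m q^T = 0 by rewrite cE -mulmxA Yq mulmx0.
  move/matrixP/(_ 0 0); rewrite !mxE => sq0.
  have : (Num.sqrt s)^-1 * s = 0.
    rewrite -[RHS]sq0 /s mulr_sumr; apply: eq_bigr => j _.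
    by rewrite !mxE expr2 mulrCA.
  by move/eqP; rewrite mulf_eq0 invr_eq0 sqrtr_eq0 leNgt s_gt0 => /eqP.
have Y1 i : \sum_j Y i j ^+ 2 <= 1.
  by rewrite rowY lerBlDr (le_trans (X1 i)) // lerDl sqr_ge0.
have [U [V [YUV U1 V1]]] := IH Y rY Y1.
exists (row_mx u U), (col_mx q V); split=> [|i k|k j].
- by rewrite (mul_row_col u U q V) -YUV addrC subrK.
- by rewrite (@mxE _ m (1 + r)); case: splitP => l _ //; rewrite (ord1 l).
- by rewrite (@mxE _ (1 + r) n); case: splitP => l _ //; rewrite (ord1 l).
Qed.
End Norms.

(** * The net of products of grid matrices *)

Section Grid.
Variables (R : realType) (K : nat).
Hypothesis K_gt0 : (0 < K)%N.

Definition grid_value (k : 'I_(2 * K).+1) : R := k%:R / K%:R - 1.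

Let KR_gt0 : 0 < K%:R :> R. Proof. by rewrite ltr0n. Qed.

Lemma grid_value_norm_le1 k : `|grid_value k| <= 1.
Proof.
have k2 : (k%:R : R) / K%:R <= 2.
  by rewrite ler_pdivrMr // -natrM ler_nat -ltnS.
have k0 : 0 <= (k%:R : R) / K%:R by rewrite divr_ge0.
by rewrite ler_norml /grid_value; apply/andP; split; lra.
Qed.

Lemma grid_round (x : R) :
  `|x| <= 1 -> exists k, `|x - grid_value k| <= K%:R^-1.
Proof.
rewrite ler_norml => /andP[x1 x2].
pose y := (x + 1) * K%:R.
have y0 : 0 <= y by rewrite mulr_ge0 //; lra.
have y2 : y <= (2 * K)%:R by rewrite natrM ler_pM2r //; lra.
have /andP[ty yt] := truncn_itv y0.
have tK : (Num.truncn y < (2 * K).+1)%N.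
  by rewrite ltnS -(ler_nat R) (le_trans ty).
exists (Ordinal tK); rewrite /grid_value /=.
have -> : x - ((Num.truncn y)%:R / K%:R - 1) = (y - (Num.truncn y)%:R) / K%:R.
  by rewrite /y; field; rewrite gt_eqF.
rewrite normrM normfV (ger0_norm (ltW KR_gt0)) ler_pdivrMr // mulVf ?gt_eqF //.
by rewrite ger0_norm ?subr_ge0 // lerBlDr nat1r ltW.
Qed.

Definition grid_mx m n (a : 'M['I_(2 * K).+1]_(m, n)) : 'M[R]_(m, n) :=
  map_mx grid_value a.

Lemma grid_mx_round m n (X : 'M[R]_(m, n)) : (forall i j, `|X i j| <= 1) ->
  exists a, forall i j, `|(X - grid_mx a) i j| <= K%:R^-1.
Proof.
move=> X1; pose k i j := xchoose (grid_round (X1 i j)).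
exists (\matrix_(i, j) k i j) => i j; rewrite !mxE.
exact: (xchooseP (grid_round (X1 i j))).
Qed.

Lemma grid_mx_delta m n (i : 'I_m) (j : 'I_n) :
  exists a, grid_mx a = delta_mx i j.
Proof.
exists (\matrix_(k, l) if (k == i) && (l == j) then ord_max else inord K).
apply/matrixP => k l; rewrite !mxE /grid_value; case: ifP => _ /=.
  by rewrite natrM mulfK ?gt_eqF //; lra.
by rewrite inordK ?divff ?gt_eqF ?subrr // ltnS leq_pmull.
Qed.

Definition net_index m r n : finType :=
  ('M['I_(2 * K).+1]_(m, r) * 'M['I_(2 * K).+1]_(r, n))%type.

Lemma card_net_index m r n :
  #|{: net_index m r n}| = ((2 * K).+1 ^ (r * (m + n)))%N.
Proof. by rewrite card_prod !card_mx card_ord -expnD mulnDr [(m * r)%N]mulnC. Qed.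

Definition net_point m r n (a : net_index m r n) : 'M[R]_(m, n) :=
  grid_mx a.1 *m grid_mx a.2.

(** This is why 0 and 1 have to be grid values. *)
Lemma net_point_delta m r n (i : 'I_m) (j : 'I_n) : (0 < r)%N ->
  exists a, @net_point m r n a = delta_mx i j.
Proof.
case: r => // r _.
have [u uE] := grid_mx_delta i (ord0 : 'I_r.+1).
have [v vE] := grid_mx_delta (ord0 : 'I_r.+1) j.
by exists (u, v); rewrite /net_point uE vE mul_delta_mx.
Qed.

(** Rounding one factor at a time, each of the r products in an entry changes by
    at most 1/K twice, because the factor left unrounded, or already rounded, has
    entries in [-1, 1]. *)
Lemma net_point_approx m r n (X : 'M[R]_(m, n)) :
    (\rank X <= r)%N -> frobenius X <= 1 ->
  exists a, entry_sum (X - @net_point m r n a) <= (2 * (m * n * r))%:R / K%:R.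
Proof.
move=> rX FX.
have [i|U [V [-> U1 V1]]] := bounded_factorization rX.
  have XX : \sum_i \sum_j X i j ^+ 2 <= 1.
    by rewrite -(@ler_sqrt _ _ 1) // sqrtr1.
  rewrite (le_trans _ XX) // (bigD1 i) //= lerDl.
  by apply: sumr_ge0 => k _; apply: sumr_ge0 => j _; exact: sqr_ge0.
have [u Uu] := grid_mx_round U1; have [v Vv] := grid_mx_round V1.
exists (u, v).
have -> : U *m V - net_point (u, v) =
    (U - grid_mx u) *m V + grid_mx u *m (V - grid_mx v).
  by rewrite mulmxBl mulmxBr addrA subrK.
have -> : (2 * (m * n * r))%:R / K%:R = 2 * r%:R / K%:R * (m * n)%:R :> R.
  by rewrite !natrM; ring.
apply: entry_sum_le => i j; rewrite mxE (le_trans (ler_normD _ _)) //.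
have le_prod (x y e f : R) : `|x| <= e -> `|y| <= f -> `|x * y| <= e * f.
  by move=> xe yf; rewrite normrM ler_pM.
have -> : 2 * r%:R / K%:R = r%:R * K%:R^-1 + r%:R * K%:R^-1 :> R by ring.
have sumc (c : R) : \sum_(k < r) c = r%:R * c.
  by rewrite sumr_const card_ord mulr_natl.
rewrite -!sumc; apply: lerD; rewrite [X in `|X|]mxE (le_trans (ler_norm_sum _ _ _)) //;
  apply: ler_sum => k _.
  by rewrite -[leRHS]mulr1; apply: le_prod.
rewrite -[leRHS]mul1r; apply: le_prod => //.
by rewrite mxE grid_value_norm_le1.
Qed.

End Grid.

(** * From the net to all matrices of low rank *)

Section Deterministic.
Variables (R : realType) (m n p r : nat).
Variable A : {linear 'M[R]_(m, n) -> 'cV[R]_p}.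
Hypothesis r_gt0 : (0 < r)%N.

Definition net_bounds K : set R :=
  [set eps | forall a, let X := @net_point R K m r n a in
     (1 - eps) * frobenius X <= euclidean (A X) <= (1 + eps) * frobenius X].

Lemma image_le_entry_sum B :
    (forall i j, euclidean (A (delta_mx i j)) <= B) ->
  forall X, euclidean (A X) <= B * entry_sum X.
Proof.
apply: (@subadditive_le_entry_sum _ _ _ (fun X => euclidean (A X))) => [X Y|a X].
  by rewrite linearD euclideanD.
by rewrite linearZ euclideanZ.
Qed.

Lemma net_bounds_delta K eps i j : (0 < K)%N -> net_bounds K eps ->
  euclidean (A (delta_mx i j)) <= 1 + eps.
Proof.
move=> K0 Aeps; have [a aE] := net_point_delta R K0 i j r_gt0.
have /andP[_] := Aeps a.
by rewrite aE frobenius_delta mulr1.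
Qed.

(** For X of norm 1 and a net point Y with entry_sum (X - Y) <= c, replacing Y by
    X changes its norm by at most c and the norm of its image by at most B * c.
    The net bounds multiply the first change by 1 - eps or 1 + eps, hence by at
    most 2, which gives (B + 2) * c. *)
Lemma net_bounds_rip K (eps B : R) :
    (0 < K)%N -> 0 <= eps <= 1 -> 0 <= B -> net_bounds K eps ->
    (forall i j, euclidean (A (delta_mx i j)) <= B) ->
  rip_bounds A r (eps + (B + 2) * ((2 * (m * n * r))%:R / K%:R)).
Proof.
move=> K0 /andP[eps0 eps1] B0 Aeps AB; set c := _ / _.
have unit_bound (X : 'M[R]_(m, n)) : (\rank X <= r)%N -> frobenius X = 1 ->
    1 - (eps + (B + 2) * c) <= euclidean (A X) <= 1 + (eps + (B + 2) * c).
  move=> rX FX.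
  have [|a] := @net_point_approx R K K0 m r n X rX; first by rewrite FX.
  have /andP[] := Aeps a; set Y := net_point R a => AY1 AY2.
  set e := entry_sum _; rewrite -/c => ec.
  have AXY := image_le_entry_sum AB (X - Y); rewrite -/e in AXY.
  have FXY := frobenius_le_entry_sum (X - Y); rewrite -/e in FXY.
  have e0 : 0 <= e by exact: le_trans (frobenius_ge0 _) FXY.
  have entryN (Z : 'M[R]_(m, n)) : entry_sum (- Z) = entry_sum Z.
    by apply: eq_bigr => i _; apply: eq_bigr => j _; rewrite mxE normrN.
  have eN : entry_sum (Y - X) = e by rewrite -opprB entryN.
  have AYX := image_le_entry_sum AB (Y - X); rewrite eN in AYX.
  have FYX := frobenius_le_entry_sum (Y - X); rewrite eN in FYX.
  have FY : frobenius Y <= 1 + e.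
    by have := frobeniusD (Y - X) X; rewrite subrK FX; lra.
  have FY' : 1 <= frobenius Y + e.
    by have := frobeniusD (X - Y) Y; rewrite subrK FX; lra.
  have AX : euclidean (A X) <= euclidean (A Y) + B * e.
    by have := euclideanD (A (X - Y)) (A Y); rewrite -linearD subrK; lra.
  have AX' : euclidean (A Y) <= euclidean (A X) + B * e.
    by have := euclideanD (A (Y - X)) (A X); rewrite -linearD subrK; lra.
  have Be : B * e <= B * c by rewrite ler_wpM2l.
  apply/andP; split; nra.
move=> X rX; have [X0|FX0] := eqVneq (frobenius X) 0.
  rewrite X0 !mulr0 (frobenius_eq0 X0) linear0 -[Z in euclidean Z](scale0r 0).
  by rewrite euclideanZ normr0 mul0r lexx.
have FX : 0 < frobenius X by rewrite lt_def FX0 frobenius_ge0.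
have /andP[] : 1 - (eps + (B + 2) * c) <= (frobenius X)^-1 * euclidean (A X)
    <= 1 + (eps + (B + 2) * c).
  have := unit_bound ((frobenius X)^-1 *: X).
  rewrite linearZ euclideanZ frobeniusZ mxrank_scale_nz ?invr_neq0 //.
  by rewrite ger0_norm ?invr_ge0 ?(ltW FX) // mulVf //; apply.
rewrite ler_pdivlMl // ler_pdivrMl // => X1 X2.
by rewrite ![_ * frobenius X]mulrC X1 X2.
Qed.

End Deterministic.

(** * The restricted isometry constant *)

Section RestrictedIsometry.
Variables (R : realType) (m n p r : nat).
Hypotheses (m_gt0 : (0 < m)%N) (n_gt0 : (0 < n)%N) (r_gt0 : (0 < r)%N).
Variable A : {linear 'M[R]_(m, n) -> 'cV[R]_p}.
Implicit Type d : R.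

Lemma delta_images_bounded :
  exists2 B, 0 <= B & forall i j, euclidean (A (delta_mx i j)) <= B.
Proof.
pose F (ij : 'I_m * 'I_n) := euclidean (A (delta_mx ij.1 ij.2)).
exists (\sum_ij F ij) => [|i j]; first by apply: sumr_ge0 => ij _; exact: euclidean_ge0.
by rewrite (bigD1 (i, j)) //= lerDl sumr_ge0 // => ij _; exact: euclidean_ge0.
Qed.

Lemma entry_le_frobenius (X : 'M[R]_(m, n)) i j : `|X i j| <= frobenius X.
Proof.
rewrite -sqrtr_sqr ler_wsqrtr // pair_bigA (bigD1 (i, j)) //= lerDl.
by apply: sumr_ge0 => ij _; exact: sqr_ge0.
Qed.

(** Since [inf] of the empty set is 0, this is needed to read an upper bound on
    the restricted isometry constant as a statement on the map. *)
Lemma rip_bounds_nonempty : rip_bounds A r !=set0.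
Proof.
have [B B0 AB] := delta_images_bounded.
exists (1 + B * (m * n)%:R) => X _.
have FX := frobenius_ge0 X; have AX := euclidean_ge0 (A X).
have AXB : euclidean (A X) <= B * (m * n)%:R * frobenius X.
  apply: le_trans (image_le_entry_sum AB X) _.
  rewrite -mulrA ler_wpM2l // mulrC; apply: entry_sum_le => i j.
  exact: entry_le_frobenius.
have c0 : 0 <= B * (m * n)%:R by rewrite mulr_ge0.
by apply/andP; split; nra.
Qed.

Lemma rip_bounds_ge0 d : rip_bounds A r d -> 0 <= d.
Proof.
move=> /(_ (delta_mx (Ordinal m_gt0) (Ordinal n_gt0))).
by rewrite mxrank_delta frobenius_delta !mulr1 => /(_ r_gt0) /andP[]; lra.
Qed.

Lemma rip_bounds_le d d' : d <= d' -> rip_bounds A r d -> rip_bounds A r d'.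
Proof.
move=> dd' Ad X /Ad /andP[]; have := frobenius_ge0 X.
by move=> *; apply/andP; split; nra.
Qed.

Lemma rip_bounds_closed d :
  (forall e, 0 < e -> rip_bounds A r (d + e)) -> rip_bounds A r d.
Proof.
move=> Ad X rX; have FX := frobenius_ge0 X.
have F1 : 0 < frobenius X + 1 by rewrite ltr_wpDl.
have step e : 0 < e -> e / (frobenius X + 1) * frobenius X <= e.
  by move=> e0; rewrite mulrAC ler_pdivrMr // ler_pM2l // lerDl.
apply/andP; split; apply/ler_addgt0Pr => e e0;
  have /andP[] := Ad (e / (frobenius X + 1)) (divr_gt0 e0 F1) X rX;
  have := step e e0; rewrite ?mulrBl ?mulrDl; lra.
Qed.

(** The set of admissible constants is nonempty, bounded below, closed and upward
    closed, so it contains everything from its infimum on. *)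
Lemma restricted_isometry_constant_leP d :
  restricted_isometry_constant A r <= d <-> rip_bounds A r d.
Proof.
have lb : has_lbound (rip_bounds A r) by exists 0 => e; exact: rip_bounds_ge0.
split=> [ric_d|]; last exact: ge_inf.
apply: rip_bounds_closed => e e0.
have [] := @inf_adherent _ (rip_bounds A r) e e0.
  by split=> //; exact: rip_bounds_nonempty.
move=> d' Ad' d'e; apply: rip_bounds_le Ad'.
by rewrite (le_trans (ltW d'e)) // lerD2r.
Qed.

(** Net points have rank at most r, and as K grows the error of [net_bounds_rip]
    tends to 0 for a fixed map.  The right-hand side involves countably many
    matrices only, hence defines a measurable event. *)
Lemma rip_bounds_netP d : 0 <= d <= 1 ->
  rip_bounds A r d <-> forall K, (0 < K)%N -> net_bounds r A K d.
Proof.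
move=> d01; split=> [Ad K _ a|Ad].
  by apply: Ad; rewrite (leq_trans (mxrankM_maxl _ _)) // rank_leq_col.
apply: rip_bounds_closed => e e0.
have [B B0 AB] := delta_images_bounded.
set D : R := (2 * (m * n * r))%:R.
have D0 : 0 <= (B + 2) * D by rewrite mulr_ge0 // addr_ge0.
pose K := (Num.truncn ((B + 2) * D / e)).+1.
have := net_bounds_rip (isT : (0 < K)%N) d01 B0 (Ad K isT) AB.
apply: rip_bounds_le; rewrite lerD2l mulrA ler_pdivrMr // [e * _]mulrC -ler_pdivrMr //.
by have /andP[_ /ltW] := truncn_itv (divr_ge0 D0 (ltW e0)).
Qed.

End RestrictedIsometry.

(** * Measurability and the union bound *)

Section Probability.
Variables (R : realType) (m n p r : nat).
Variables (d : measure_display) (T : measurableType d).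
Variable A : T -> {linear 'M[R]_(m, n) -> 'cV[R]_p}.
Hypothesis mA : measurable_linear_map A.

Lemma measurable_euclidean_image X :
  measurable_fun [set: T] (fun w => euclidean (A w X)).
Proof.
apply: (@measurableT_comp _ _ _ _ _ _ (@Num.sqrt R)).
  by apply: continuous_measurable_fun; exact: sqrt_continuous.
by apply: measurable_sum => i; apply: measurable_funX; exact: mA.
Qed.

Lemma measurable_bounds a b X :
  measurable [set w | a <= euclidean (A w X) <= b].
Proof.
have -> : [set w | a <= euclidean (A w X) <= b] =
    [set w | a <= euclidean (A w X)] `&` [set w | euclidean (A w X) <= b].
  by apply/seteqP; split => w /=; [move/andP|case=> -> ->].
apply: measurableI; rewrite -[X in measurable X]setTI;
  by apply: measurable_fun_le => //; exact: measurable_euclidean_image.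
Qed.

Lemma measurable_net_bounds K eps : measurable [set w | net_bounds r (A w) K eps].
Proof.
have -> : [set w | net_bounds r (A w) K eps] =
    \bigcap_(a in [set: net_index K m r n]) [set w | let X := net_point R a in
     (1 - eps) * frobenius X <= euclidean (A w X) <= (1 + eps) * frobenius X].
  by apply/seteqP; split => w Aw => [a _|a]; exact: Aw.
apply: fin_bigcap_measurable => [|a _]; first exact: finite_finset.
exact: measurable_bounds.
Qed.

Lemma measurable_ric_le delta :
    (0 < m)%N -> (0 < n)%N -> (0 < r)%N -> 0 <= delta <= 1 ->
  measurable [set w | restricted_isometry_constant (A w) r <= delta].
Proof.
move=> m0 n0 r0 delta01.
have -> : [set w | restricted_isometry_constant (A w) r <= delta] =
    \bigcap_(K in [set K | (0 < K)%N]) [set w | net_bounds r (A w) K delta].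
  apply/seteqP; split => w /=.
    by move/(restricted_isometry_constant_leP m0 n0 r0)/rip_bounds_netP; apply.
  move=> Aw; apply/(restricted_isometry_constant_leP m0 n0 r0).
  by apply/rip_bounds_netP => // K K0; apply: Aw.
by apply: bigcap_measurableType => K _; exact: measurable_net_bounds.
Qed.

Lemma union_bound (P : probability T R) (I : Type) (s : seq I)
    (F : I -> set T) (c : R) :
    (forall i, measurable (F i)) -> (forall i, (P (F i) <= c%:E)%E) ->
  (P (\big[setU/set0]_(i <- s) F i) <= ((size s)%:R * c)%:E)%E.
Proof.
move=> mF Fc; elim: s => [|i s IH]; first by rewrite big_nil measure0 mul0r.
rewrite big_cons (le_trans (measureU2 _ _ _)) //; first exact: bigsetU_measurable.
by rewrite /= -nat1r mulrDl mul1r EFinD leeD.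
Qed.

(** Bounds 1 - eps and 1 + eps on the ratio of the squared norms pass to the ratio
    of the norms, because (1 - eps) ^+ 2 <= 1 - eps and 1 + eps <= (1 + eps) ^+ 2.
    At a net point equal to 0 the bounds hold trivially. *)
Lemma net_bounds_probability (P : probability T R) K eps c :
    0 < eps < 1 -> 0 <= c ->
    (forall X : 'M[R]_(m, n), X != 0 ->
      (P [set w | (eps * frobenius X ^+ 2 <=
                   `|euclidean (A w X) ^+ 2 - frobenius X ^+ 2|)%R] <= c%:E)%E) ->
  (P (~` [set w | net_bounds r (A w) K eps]) <=
     (((2 * K).+1 ^ (r * (m + n)))%:R * c)%:E)%E.
Proof.
move=> /andP[eps0 eps1] c0 Pc.
pose good (a : net_index K m r n) :=
  [set w | let X := net_point R a in
     (1 - eps) * frobenius X <= euclidean (A w X) <= (1 + eps) * frobenius X].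
have mgood a : measurable (good a) by exact: measurable_bounds.
have -> : ~` [set w | net_bounds r (A w) K eps] =
    \big[setU/set0]_(a <- enum {: net_index K m r n}) ~` good a.
  rewrite -bigcup_seq; apply/seteqP; split => w.
    by move/existsNP => [a Aa]; exists a => //=; rewrite mem_enum.
  by move=> [a _ Aa] Aw; apply: Aa; exact: Aw.
rewrite -card_net_index cardE.
apply: union_bound => a; first exact: measurableC.
set X := net_point R a.
have [X0|X0] := eqVneq X 0.
  suff -> : ~` good a = set0 by rewrite measure0 lee_fin.
  apply/seteqP; split => w //; apply; rewrite /good /= -/X X0 linear0.
  have z k l : frobenius (0 : 'M[R]_(k, l)) = 0.
    by rewrite -(scale0r 0) frobeniusZ normr0 mul0r.
  have ze : euclidean (0 : 'cV[R]_p) = 0.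
    by rewrite -(scale0r 0) euclideanZ normr0 mul0r.
  by rewrite z ze !mulr0 lexx.
apply: le_trans (Pc X X0); apply: le_measure; rewrite ?inE.
- exact: measurableC.
- rewrite -[X in measurable X]setTI; apply: measurable_fun_le => //.
  apply: (@measurableT_comp _ _ _ _ _ _ (@Num.norm R R)).
    exact: normr_measurable.
  apply: measurable_funB => //; apply: measurable_funX.
  exact: measurable_euclidean_image.
move=> w; rewrite /good /= -/X => bad; rewrite leNgt; apply/negP => close.
apply: bad; have FX := frobenius_ge0 X; have AX := euclidean_ge0 (A w X).
move: close; rewrite ltr_norml => /andP[h1 h2].
rewrite -(ler_pXn2r (ltn0Sn 1)) ?nnegrE ?mulr_ge0 ?subr_ge0 ?(ltW eps1) //.
rewrite -[X in _ && X](ler_pXn2r (ltn0Sn 1)) ?nnegrE ?mulr_ge0 ?addr_ge0 ?(ltW eps0) //.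
have F2 := sqr_ge0 (frobenius X).
by rewrite !exprMn; apply/andP; split; nra.
Qed.

End Probability.

(** * The choice of the constants *)

(** With L = ln N, the logarithm of 2 (2K + 1)^s for K = Q N^2 is at most
    ln 2 + s (ln (3Q) + 2L).  As L >= ln 2 and s >= 1, this is at most
    s L (3 + ln (3Q) / ln 2), which is at most half of kappa * x. *)
Lemma net_union_bound (R : realType) (Q s N : nat) (kappa x : R) :
    (0 < Q)%N -> (1 < N)%N -> (0 < s)%N -> 0 < kappa ->
    2 / kappa * (3 + ln (3 * Q%:R) / ln 2) * s%:R * ln N%:R <= x ->
  ((2 * (Q * N ^ 2)).+1 ^ s)%:R * (2 * expR (- (kappa * x))) <=
    expR (- (kappa / 2 * x)).
Proof.
move=> Q0 N1 s0 k0 hx.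
have l2 : 0 < ln 2 :> R by rewrite ln_gt0 // ltr1n.
have N0 : (0 < N)%N by exact: ltnW.
have lN : ln 2 <= ln N%:R :> R by rewrite ler_ln ?posrE ?ltr0n // ler_nat.
have Q1 : 1 <= 3 * Q%:R :> R by rewrite -natrM (ler_nat _ 1) muln_gt0.
have lQ : 0 <= ln (3 * Q%:R) :> R by rewrite ln_ge0.
set L := ln N%:R in lN hx; set q := ln (3 * _) in lQ hx.
have eN : (N%:R : R) = expR L by rewrite lnK // posrE ltr0n.
have eQ : (3 * Q%:R : R) = expR q by rewrite lnK // posrE (lt_le_trans ltr01).
have e2 : (2 : R) = expR (ln 2) by rewrite lnK // posrE.
have base : ((2 * (Q * N ^ 2)).+1)%:R <= expR (q + 2 * L).
  rewrite expRD expRM_natl -eN -eQ -mulrA -!natrX -!natrM ler_nat.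
  rewrite -[ltnRHS]/(_ * _)%N.
  by rewrite (mulSn 2) -add1n leq_add2r muln_gt0 Q0 expn_gt0 N0.
rewrite natrX.
apply: (@le_trans _ _ (expR (s%:R * (q + 2 * L)) * (2 * expR (- (kappa * x))))).
  by rewrite ler_wpM2r ?mulr_ge0 ?expR_ge0 // expRM_natl lerXn2r ?nnegrE ?expR_ge0.
rewrite {2}e2 -!expRD ler_expR.
have s1 : 1 <= s%:R :> R by rewrite (ler_nat _ 1).
have key : s%:R * L * (3 + q / ln 2) <= kappa / 2 * x.
  have -> : kappa / 2 * x = x / (2 / kappa) by field; rewrite gt_eqF.
  rewrite ler_pdivlMr ?divr_gt0 //; apply: le_trans hx; rewrite le_eqVlt.
  by apply/orP; left; apply/eqP; ring.
have q2 : q <= L * (q / ln 2).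
  by rewrite mulrCA ler_peMr // ler_pdivlMr // mul1r.
have L0 : 0 <= L by exact: le_trans (ltW l2) lN.
have sL : L <= s%:R * L by rewrite ler_peMl.
have sq : s%:R * q <= s%:R * (L * (q / ln 2)) by rewrite ler_wpM2l.
have : kappa * x = kappa / 2 * x + kappa / 2 * x by field.
lra.
Qed.

Theorem theorem4p2 (R : realType) (gamma delta : R)
    (gamma_gt0 : 0 < gamma) (delta_gt0 : 0 < delta) (delta_lt1 : delta < 1) :
  exists c0 c1 : R, [/\ 0 < c0, 0 < c1 &
    forall (m n p r : nat),
      (m <= n)%N -> (1 < m * n)%N -> (1 <= r)%N -> (r <= m)%N ->
    forall (d : measure_display) (T : measurableType d) (P : probability T R)
      (A : T -> {linear 'M[R]_(m, n) -> 'cV[R]_p}),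
      nearly_isometric gamma P A ->
      c0 * r%:R * (m + n)%:R * ln ((m * n)%:R) <= p%:R ->
      ((1 - expR (- (c1 * p%:R)))%:E <=
       P [set w | (restricted_isometry_constant (A w) r <= delta)%R])%E].
Proof.
pose eps := delta / 2.
have eps01 : 0 < eps < 1 by rewrite /eps; apply/andP; split; lra.
pose kappa := (eps ^+ 2 / 2 - eps ^+ 3 / 3) / 2.
have kappa_gt0 : 0 < kappa.
  have -> : kappa = eps ^+ 2 * (1 / 2 - eps / 3) / 2 by rewrite /kappa; field.
  by case/andP: eps01 => *; rewrite divr_gt0 ?mulr_gt0 ?exprn_gt0 //; lra.
(* By [net_bounds_rip] with B = 2, going from the net to all matrices costs at
   most 4 * (2 / Q) = 8 / Q, which has to be at most delta / 2. *)
pose Q := (Num.truncn (16 / delta)).+1.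
have deltaQ : 16 / Q%:R <= delta.
  rewrite ler_pdivrMr ?ltr0n // mulrC -ler_pdivrMr //.
  by have /andP[_ /ltW] := truncn_itv (divr_ge0 (ler0n R 16) (ltW delta_gt0)).
pose c0 := 2 / kappa * (3 + ln (3 * Q%:R) / ln 2).
have Q1 : 1 <= 3 * Q%:R :> R by rewrite -natrM (ler_nat _ 1) muln_gt0.
exists c0, (kappa / 2); split.
- have : 0 <= ln (3 * Q%:R) / ln 2 :> R.
    by rewrite divr_ge0 // ln_ge0 // (ler_nat _ 1).
  by move=> ?; apply: mulr_gt0; [rewrite divr_gt0|lra].
- by rewrite divr_gt0.
move=> m n p r _ mn1 r0 rm d T P A [mA _ concentration _] hp.
have m0 : (0 < m)%N := leq_trans r0 rm.
have n0 : (0 < n)%N by case: n mn1 {A mA concentration hp} => //; rewrite muln0.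
(* One factor m * n is the number of entries, the other one bounds r. *)
pose K := (Q * (m * n) ^ 2)%N.
have K0 : (0 < K)%N by rewrite muln_gt0 expn_gt0 muln_gt0 m0 n0.
pose G := [set w | net_bounds r (A w) K eps].
have mG : measurable G by exact: measurable_net_bounds.
have GP : (P (~` G) <= (expR (- (kappa / 2 * p%:R)))%:E)%E.
  have c_ge0 : 0 <= 2 * expR (- (kappa * p%:R)) by rewrite mulr_ge0 // expR_ge0.
  apply: le_trans (net_bounds_probability r mA K eps01 c_ge0 _) _.
    move=> X X0; case/andP: eps01 => e0 e1.
    have := concentration X eps X0 e0 e1.
    have -> : p%:R / 2 * (eps ^+ 2 / 2 - eps ^+ 3 / 3) = kappa * p%:R.
      by rewrite /kappa; field.
    exact.
  rewrite lee_fin; apply: net_union_bound => //.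
    by rewrite muln_gt0 r0 addn_gt0 m0.
  by rewrite natrM mulrA.
have GRIC : G `<=` [set w | restricted_isometry_constant (A w) r <= delta].
  move=> w Gw; apply/restricted_isometry_constant_leP => //.
  have eps01' : 0 <= eps <= 1 by case/andP: eps01 => *; rewrite !ltW.
  have delta_le2 i j : euclidean (A w (delta_mx i j)) <= 2.
    apply: le_trans (net_bounds_delta r0 _ _ K0 Gw) _.
    by case/andP: eps01' => *; lra.
  apply: rip_bounds_le (net_bounds_rip K0 eps01' (ler0n R 2) Gw delta_le2).
  have mnr : (2 * (m * n * r))%:R / K%:R <= 2 / Q%:R :> R.
    rewrite ler_pdivrMr ?ltr0n // mulrAC ler_pdivlMr ?ltr0n // -!natrM ler_nat.
    have rmn : (r <= m * n)%N by rewrite (leq_trans rm) // leq_pmulr.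
    by rewrite -mulnA leq_mul2l [(_ * Q)%N]mulnC leq_mul2l -mulnn leq_mul2l rmn !orbT.
  by rewrite /eps; lra.
have ricM : measurable [set w | restricted_isometry_constant (A w) r <= delta].
  by apply: measurable_ric_le => //; rewrite !ltW.
apply: (@le_trans _ _ (P G)); last by apply: le_measure; rewrite ?inE.
rewrite -[G]setCK probability_setC; last exact: measurableC.
by rewrite EFinB leeB.
Qed.
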